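(* Let $n\ge d\ge 1$ be integers. If $r_1(t)>\cdots>r_d(t)>0$, $t\ge 0$, satisfy the ODE system $$\dot r_k(t)=\sum_{j\colon j\ne k}\left(\frac{1}{r_k(t)-r_j(t)}+\frac{1}{r_k(t)+r_j(t)}\right)+\frac{n+1}{r_k(t)},\qquad k=1,\dots,d,$$ then $$\sum_{k=1}^d r_k(t)\,\dot r_k(t)=d(n+d).$$ Consequently, $$\sum_{k=1}^d r_k(t)^2=\sum_{k=1}^d r_k(0)^2+2d(n+d)\,t$$ for all $t\ge 0$, so that the first moment $\frac1d\sum_{k=1}^d r_k(t)^2$ of the root distribution of $p(x,t)=\prod_{k=1}^d(x-r_k(t)^2)$ grows linearly in time.
   Context: A dot denotes the derivative with respect to $t$ (one-sided at $t=0$). Sums over $j$ with $j\neq k$ range over $\{1,\dots,d\}\setminus\{k\}$. The root distribution of a monic polynomial with roots $a_1,\dots,a_d$ is the probability measure $\frac1d\sum_{k=1}^d\delta_{a_k}$. *)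

(* Defs.v *)
From HB Require Import structures.
From mathcomp Require Import all_boot all_order all_algebra.
From mathcomp Require Import all_classical all_reals all_analysis.
Set Implicit Arguments.
Unset Strict Implicit.
Unset Printing Implicit Defensive.
Import Order.TTheory GRing.Theory Num.Theory.
Import numFieldNormedType.Exports.
Local Open Scope classical_set_scope.
Local Open Scope ring_scope.

(* Functions of time t >= 0 are total functions on R whose values at negative
   times are irrelevant: the derivative is one-sided at t = 0 and two-sided
   for t > 0. *)
Definition time_derivable (R : realType) (f : R -> R) (t : R) : Prop :=
  if t == 0 then cvg (h^-1 * (f h - f 0) @[h --> 0^'+])
  else derivable f t 1.

Definition time_derivative (R : realType) (f : R -> R) (t : R) : R :=
  if t == 0 then lim (h^-1 * (f h - f 0) @[h --> 0^'+])
  else (f^`())%classic t.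

(* The roots of p with multiplicity, listed in an arbitrary order; this is
   meaningful for monic polynomials that split over R, and [::] otherwise. *)
Definition roots_of (R : realType) (p : {poly R}) : seq R :=
  xget [::] [set s : seq R | p = \prod_(a <- s) ('X - a%:P)].

Lemma inv_nat_ge0 (R : realType) (m : nat) : 0 <= (m%:R^-1 : R).
Proof. by rewrite invr_ge0 ler0n. Qed.

Definition empirical_measure (R : realType) (s : seq R) :
    {measure set (measurableTypeR R) -> \bar R} :=
  mscale (NngNum (inv_nat_ge0 R (size s)))
    (msum (fun k => \d_(nth 0 s k : measurableTypeR R)) (size s)).

Definition root_distribution (R : realType) (p : {poly R}) :
    {measure set (measurableTypeR R) -> \bar R} :=
  empirical_measure (roots_of p).

Definition first_moment (R : realType)
    (mu : {measure set (measurableTypeR R) -> \bar R}) : \bar R :=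
  (\int[mu]_x x%:E)%E.

Lemma roots_ofP (R : realType) (s : seq R) :
  perm_eq (roots_of (\prod_(a <- s) ('X - a%:P))) s.
Proof.
rewrite /roots_of; case: xgetP => [u _ /= e|/(_ s)] //=.
by rewrite perm_sym; apply: prod_XsubC_eq.
Qed.

Lemma empirical_measure_setT (R : realType) (s : seq R) :
  (0 < size s)%N -> empirical_measure s setT = 1%E.
Proof.
move=> s0; rewrite /empirical_measure /= /mscale /= /msum /=.
under eq_bigr do rewrite diracT.
rewrite sumEFin sumr_const card_ord -EFinM mulVf //.
by rewrite pnatr_eq0 -lt0n.
Qed.

(* Main.v *)
Require Import Defs.
From HB Require Import structures.
From mathcomp Require Import all_boot all_order all_algebra.
From mathcomp Require Import all_classical all_reals all_analysis.
From mathcomp Require Import measurable_realfun ring lra.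
Import Order.TTheory GRing.Theory Num.Theory.
Import numFieldNormedType.Exports.
Local Open Scope classical_set_scope.
Local Open Scope ring_scope.

(** Multiplying the [k]-th equation by [r_k] and summing turns the interaction
    into a sum over ordered pairs of distinct indices of
    [r_k / (r_k - r_j) + r_k / (r_k + r_j)].  Exchanging [k] and [j] and
    averaging replaces the summand by [1]: the pair [(k, j)] and its reverse
    contribute [1] through the differences and [1] through the sums, [2]
    altogether.  The [d (d - 1)] ordered pairs therefore add up to
    [d (d - 1)], and the [d] terms [r_k * (n + 1) / r_k] bring the
    total to [d (d - 1) + d (n + 1) = d (n + d)] ([sum_mul_repulsion]).

    The sum of squares thus has constant derivative [2 d (n + d)] at positive
    times.  Differentiability from the right makes it right-continuous at [0],
    so the mean value theorem applies on [[0, t]] and the growth is exactly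
    linear ([constant_rate_affine]).

    The statement about moments follows because the roots of a product of
    linear factors, listed in any order, are a permutation of the given ones,
    and because the mean of an empirical measure is the arithmetic mean of its
    atoms ([first_moment_root_distribution]). *)

(** The average of the double sum and of its transpose has all its terms equal
    to [c]. *)
Lemma sum_offdiag_symmetrize (R : numFieldType) (d : nat)
    (f : 'I_d -> 'I_d -> R) (c : R) :
  (forall k j, j != k -> f k j + f j k = c *+ 2) ->
  \sum_(k < d) \sum_(j < d | j != k) f k j = c *+ (d * d.-1).
Proof.
move=> fc; set S := LHS.
have transp : S = \sum_(k < d) \sum_(j < d | j != k) f j k.
  rewrite /S (exchange_big_dep predT) //=; apply: eq_bigr => k _.
  by apply: eq_bigl => j; rewrite eq_sym.
suff S2 : S *+ 2 = c *+ (d * d.-1) *+ 2.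
  by apply/eqP; rewrite -(eqr_pMn2r (n := 2)) //; apply/eqP.
rewrite {1}mulr2n {2}transp -big_split /= -mulrnA mulnC mulrnA.
rewrite -[in RHS](card_ord d) mulnC mulrnA -sumr_const.
apply: eq_bigr => k _; rewrite -big_split /=.
rewrite (eq_bigr (fun=> c *+ 2)) => [|j jk]; last by rewrite fc.
rewrite sumr_const; congr (_ *+ _).
by rewrite cardC1 card_ord.
Qed.

(** After multiplication by [x k] the sum no longer depends on the positions:
    [a / (a - b) + b / (b - a) = 1] and [a / (a + b) + b / (b + a) = 1]. *)
Lemma sum_mul_repulsion (R : numFieldType) (n d : nat) (x : 'I_d -> R) :
  (forall k, x k != 0) ->
  (forall k j, j != k -> x k - x j != 0) ->
  (forall k j, j != k -> x k + x j != 0) ->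
  \sum_(k < d) x k * (\sum_(j < d | j != k) ((x k - x j)^-1 + (x k + x j)^-1)
                      + (n + 1)%:R / x k) = (d * (n + d))%:R.
Proof.
move=> x0 xB xD.
under eq_bigr => k _ do rewrite mulrDr mulr_sumr (mulrCA (x k)) divff// mulr1.
rewrite big_split /= (@sum_offdiag_symmetrize _ _ _ 1) => [|k j jk].
  rewrite sumr_const card_ord -mulrnA -natrD; congr (_%:R).
  by case: (d) => [|m]; rewrite /= ?muln0//; ring.
have B0 := xB k j jk.
have B0' : x j - x k != 0 by rewrite -opprB oppr_eq0.
have D0' : x j + x k != 0 by rewrite addrC; exact: xD.
by field; rewrite B0 B0' D0'.
Qed.

(** Near [0], [f h] is [h] times the difference quotient plus [f 0], and the
    quotient converges. *)
Lemma time_derivable_right_continuous (R : realType) (f : R -> R) :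
  time_derivable f 0 -> f h @[h --> 0^'+] --> f 0.
Proof.
rewrite /time_derivable eqxx => fd.
have h0 : h @[h --> (0 : R)^'+] --> (0 : R).
  exact: cvg_within.
have : h * (h^-1 * (f h - f 0)) + f 0 @[h --> 0^'+]
    --> 0 * lim (h^-1 * (f h - f 0) @[h --> 0^'+]) + f 0.
  by apply: cvgD; [exact: cvgM|exact: cvg_cst].
rewrite mul0r add0r => lim_f.
apply: cvg_trans lim_f; apply: near_eq_cvg.
near=> h => /=.
by rewrite mulrA divff ?mul1r ?subrK// gt_eqF//; near: h; exact: nbhs_right_gt.
Unshelve. all: by end_near. Qed.

Lemma time_derivable_is_derive (R : realType) (f : R -> R) (t : R) :
  0 < t -> time_derivable f t -> is_derive t 1 f (time_derivative f t).
Proof.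
move=> t0; rewrite /time_derivable /time_derivative gt_eqF// => fd.
by rewrite derive1E; apply: DeriveDef.
Qed.

(** The mean value theorem asks for continuity at the endpoint [0]; stating it
    as right-continuity avoids one-sided differentiation rules for sums and
    squares, since right limits already commute with both. *)
Lemma constant_rate_affine (R : realType) (g : R -> R) (c t : R) :
  0 <= t -> (forall s : R, 0 < s -> is_derive s 1 g c) ->
  g h @[h --> 0^'+] --> g 0 -> g t = g 0 + c * t.
Proof.
rewrite le_eqVlt => /predU1P[<-|t0] dg g0; first by rewrite mulr0 addr0.
have cont (s : R) : 0 < s -> {for s, continuous g}.
  move=> /dg ds; apply/differentiable_continuous/derivable1_diffP.
  exact: (@ex_derive _ _ _ _ _ _ _ ds).
have [||x _ /eqP] := @MVT R g (fun=> c) 0 t t0.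
- by move=> s; rewrite in_itv => /andP[s0 _]; exact: dg.
- apply/continuous_within_itvP => //; split => //.
    by move=> s; rewrite in_itv => /andP[s0 _]; exact: cont.
  by apply: cvg_at_left_filter; exact: cont.
by rewrite subr0 subr_eq addrC => /eqP.
Qed.

(** Nonnegativity of [h] gives access to the additivity of the integral in the
    measure without any integrability condition. *)
Lemma ge0_integral_empirical (R : realType) (s : seq R) (h : R -> R) :
  measurable_fun [set: measurableTypeR R] h -> (forall x, 0 <= h x) ->
  (\int[empirical_measure s]_x (h x)%:E
   = ((size s)%:R^-1 * \sum_(a <- s) h a)%:E)%E.
Proof.
move=> mh h0.
have /measurable_EFinP mEh := mh.
rewrite ge0_integral_mscale//; last by move=> x _; rewrite lee_fin.
rewrite ge0_integral_measure_sum//; last by move=> x _; rewrite lee_fin.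
rewrite EFinM; congr (_ * _)%E.
rewrite (big_nth 0) big_mkord -sumEFin; apply: eq_bigr => i _.
by rewrite integral_dirac//= diracT mul1e.
Qed.

(** The identity function has no sign, so it is split into its positive and
    negative parts; both have a finite integral, so the difference is a genuine
    real subtraction. *)
Lemma first_moment_empirical (R : realType) (s : seq R) :
  first_moment (empirical_measure s) = ((size s)%:R^-1 * \sum_(a <- s) a)%:E.
Proof.
rewrite /first_moment integralE.
have -> : ((fun x : R => x%:E)^\+ = fun x => (Num.max x 0)%:E)%E.
  by apply/funext => x; rewrite funeposE EFin_max.
have -> : ((fun x : R => x%:E)^\- = fun x => (Num.max (- x) 0)%:E)%E.
  by apply/funext => x; rewrite funenegE EFin_max.
rewrite !ge0_integral_empirical; last first.
- by move=> x; rewrite le_max lexx orbT.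
- exact: measurable_maxr.
- by move=> x; rewrite le_max lexx orbT.
- by apply: measurable_maxr => //; exact: measurableT_comp.
rewrite -EFinB -mulrBr -sumrB; congr (_ * _)%:E; apply: eq_bigr => a _.
by case: (lerP a 0) => a0; case: (lerP (- a) 0) => b0; lra.
Qed.

Lemma first_moment_root_distribution (R : realType) (s : seq R) :
  first_moment (root_distribution (\prod_(a <- s) ('X - a%:P))) =
  ((size s)%:R^-1 * \sum_(a <- s) a)%:E.
Proof.
have sP := roots_ofP s.
by rewrite first_moment_empirical (perm_size sP) (perm_big _ sP).
Qed.

Theorem proposition3p5 (R : realType) (n d : nat) (r : 'I_d -> R -> R)
  (d_ge1 : (1 <= d)%N) (d_le_n : (d <= n)%N)
  (r_decr : forall t : R, 0 <= t ->
     forall i j : 'I_d, (i < j)%N -> r j t < r i t)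
  (r_gt0 : forall t : R, 0 <= t -> forall k : 'I_d, 0 < r k t)
  (r_derivable : forall t : R, 0 <= t ->
     forall k : 'I_d, time_derivable (r k) t)
  (r_ode : forall t : R, 0 <= t -> forall k : 'I_d,
     time_derivative (r k) t =
       \sum_(j < d | j != k) ((r k t - r j t)^-1 + (r k t + r j t)^-1)
       + (n + 1)%:R / r k t) :
  forall t : R, 0 <= t ->
    [/\ \sum_(k < d) r k t * time_derivative (r k) t = (d * (n + d))%:R,
        \sum_(k < d) r k t ^+ 2 =
          \sum_(k < d) r k 0 ^+ 2 + (2 * (d * (n + d)))%:R * t,
        first_moment (root_distribution (\prod_(k < d) ('X - (r k t ^+ 2)%:P)))
          = (d%:R^-1 * \sum_(k < d) r k t ^+ 2)%:E
      & first_moment (root_distribution (\prod_(k < d) ('X - (r k t ^+ 2)%:P)))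
          = (d%:R^-1 * (\sum_(k < d) r k 0 ^+ 2) + (2 * (n + d))%:R * t)%:E].
Proof.
have virial s : 0 <= s ->
    \sum_(k < d) r k s * time_derivative (r k) s = (d * (n + d))%:R.
  move=> s0; under eq_bigr => k _ do rewrite r_ode//.
  apply: (@sum_mul_repulsion _ n d (r^~ s)) => [k|k j jk|k j _].
  - by rewrite gt_eqF ?r_gt0.
  - rewrite subr_eq0; have := jk; rewrite neq_ltn => /orP[lt_jk|lt_kj].
      by rewrite lt_eqF ?r_decr.
    by rewrite gt_eqF ?r_decr.
  - by rewrite gt_eqF ?addr_gt0 ?r_gt0.
pose g s := \sum_(k < d) r k s ^+ 2.
have gE s : 0 <= s -> g s = g 0 + (2 * (d * (n + d)))%:R * s.
  move=> s0; apply: constant_rate_affine => // [u u0|].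
    rewrite natrM -(virial u (ltW u0)) mulr_sumr.
    have -> : g = \sum_(k < d) (fun v => r k v ^+ 2).
      by apply/funext => v; rewrite fct_sumE.
    apply: is_derive_sum => k.
    have dr := time_derivable_is_derive _ _ _ u0 (r_derivable u (ltW u0) k).
    by apply: is_derive_eq; rewrite /GRing.scale /=; ring.
  apply: cvg_big => [|k _]; first exact: add_continuous.
  rewrite expr2.
  have c := time_derivable_right_continuous _ _ (r_derivable 0 (lexx _) k).
  exact: (cvgM c c).
move=> t t0.
have momE : first_moment
    (root_distribution (\prod_(k < d) ('X - (r k t ^+ 2)%:P))) =
    (d%:R^-1 * g t)%:E.
  have := first_moment_root_distribution R [seq r k t ^+ 2 | k : 'I_d].
  by rewrite !big_image size_image card_ord.
split => //; [exact: virial|exact: gE|].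
rewrite momE gE//; congr (_%:E); rewrite !natrM mulrDr; congr (_ + _).
have d0 : d%:R != 0 :> R by rewrite pnatr_eq0 -lt0n.
by field.
Qed.
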